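(* Let $F$ and $H$ be two probability distributions on $[0,\infty)$. If $F\in\mathscr{S}_2$ and there exist constants $K>0$, $c\in\mathbb{R}$ such that $$\frac{\overline{H}(x)-K\overline{F}(x)}{F(x,x+1]}\to c,\qquad x\to\infty,$$ then $H\in\mathscr{S}_2$.
   Context: For a distribution $F$ on $[0,\infty)$: $\overline{F}(x)=1-F(x)$, $F(a,b]=F(b)-F(a)$, and $F^{n*}=F^{*n}$ is the $n$-fold convolution of $F$. For $t\in(0,\infty)$ put $\Delta(t)=(0,t]$ and $F(x+\Delta(t))=F(x,x+t]$. $a(x)\sim b(x)$ means $\lim_{x\to\infty}a(x)/b(x)=1$. $F\in\mathscr{L}_{\Delta(t)}$ (local long-tailed) if $F(x+y+\Delta(t))\sim F(x+\Delta(t))$ as $x\to\infty$, uniformly in $y\in[0,1]$. $F\in\mathscr{S}_{\Delta(t)}$ (local subexponential) if $F\in\mathscr{L}_{\Delta(t)}$ and $F^{*2}(x+\Delta(t))\sim 2F(x+\Delta(t))$ as $x\to\infty$. $F\in\mathscr{S}_2$ (second order subexponential) if $F$ is a distribution on $[0,\infty)$ with finite mean $\mu$, $F\in\mathscr{S}_{\Delta(t)}$ for all $t\in(0,\infty)$, and $\overline{F^{2*}}(x)-2\overline{F}(x)\sim 2\mu F(x,x+1]$ as $x\to\infty$. *)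

(* Defs.v *)
From HB Require Import structures.
From mathcomp Require Import all_boot all_order all_algebra.
From mathcomp Require Import all_classical all_reals all_analysis.

Set Implicit Arguments.
Unset Strict Implicit.
Unset Printing Implicit Defensive.

Import Order.TTheory GRing.Theory Num.Theory.
Import numFieldNormedType.Exports.

Local Open Scope classical_set_scope.
Local Open Scope ring_scope.

(* A distribution is a Borel probability measure on the line; being carried by
   the half-line is the separate predicate [on_half_line].  The measurable
   structure is the one inferred on [R], named so as to avoid cast wrappers. *)
Notation distr R :=
  (probability (Real_sort__canonical__measurable_structure_Measurable R) R).

Section distr_convolution.
Context {R : realType}.

Definition sum_pair (z : R * R) : R := z.1 + z.2.

Lemma measurable_sum_pair : measurable_fun setT sum_pair.
Proof. exact: measurable_realfun.measurable_funD. Qed.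

HB.instance Definition _ := isMeasurableFun.Build _ _ _ _
  sum_pair measurable_sum_pair.

(* Law of the sum of two independent variables with laws F and G. *)
Definition convolution (F G : distr R) : distr R :=
  distribution (F \x G)%E sum_pair.

End distr_convolution.

Section second_order_subexponential.
Context {R : realType}.
Implicit Types (F : distr R) (a b : R -> R) (x t : R).

Definition on_half_line F : Prop := F `[0, +oo[%classic = 1%E.

Definition df F x : R := fine (F `]-oo, x]%classic).

Definition tail F x : R := 1 - df F x.

(* F(x + Delta(t)) = F(x, x + t]. *)
Definition local_mass F t x : R := df F (x + t) - df F x.

(* Since u / 0 = 0, this forces b to be eventually nonzero. *)
Definition asymp a b : Prop := a x / b x @[x --> +oo] --> (1 : R).

Definition local_long_tailed t F : Prop :=
  {uniform `[0, 1]%classic,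
    (fun x y : R => local_mass F t (x + y) / local_mass F t x) @ +oo -->
    (fun=> 1 : R)}.

Definition local_subexponential t F : Prop :=
  local_long_tailed t F /\
  asymp (local_mass (convolution F F) t) (fun x => 2 * local_mass F t x).

Definition finite_mean F : Prop := F.-integrable setT (EFin : R -> \bar R).

Definition mean F : R := fine ('E_F[(id : R -> R)]).

Definition second_order_subexponential F : Prop :=
  [/\ on_half_line F,
      finite_mean F,
      (forall t, 0 < t -> local_subexponential t F) &
      asymp (fun x => tail (convolution F F) x - 2 * tail F x)
            (fun x => 2 * mean F * local_mass F 1 x)].

End second_order_subexponential.

(* Main.v *)
Require Import Defs.
From HB Require Import structures.
From mathcomp Require Import all_boot all_order all_algebra.
From mathcomp Require Import ring lra.
From mathcomp Require Import all_classical all_reals all_analysis.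
From mathcomp Require Import measurable_realfun.
Import Order.TTheory GRing.Theory Num.Theory.
Import numFieldNormedType.Exports.
Set Implicit Arguments.
Unset Strict Implicit.
Unset Printing Implicit Defensive.
Local Open Scope classical_set_scope.
Local Open Scope ring_scope.

(** Write f(x) = F(x, x + 1] and g = tail H - K tail F, so that g / f tends to
    c.

    Local long-tailedness at every width forces F(x + y, x + y + t] ~ t f(x)
    for every real y: subdivide for rational t, squeeze for the others
    ([proportional_increments_self]). Hence H(x, x + t] is K F(x, x + t] plus
    the increment g(x) - g(x + t), which is o(f), and so it is asymptotic to
    K t f(x) ([proportional_increments_comparison]). Everything about H is
    deduced from this proportionality; finiteness of its mean comes from
    tail H = O(tail F).

    Local subexponentiality. A sum of two independent variables lies in
    (x, x + t] with the first at most A, or the second at most A, or both beyond A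
    ([local_mass_convolution]). Dominated convergence, with f(x - y) <= (A +
    2) f(x) for 0 <= y <= A as domination, gives the first two terms; if the
    summands have increments asymptotic to kappa f and lambda f, these terms
    exhaust the limit (kappa + lambda) t f(x) as A grows. So the known limit
    for F * F is equivalent to negligibility of the third term, and this
    negligibility passes from F to H because the increments of H are dominated
    by those of F ([both_large_negligible_increments]).

    Second order. The expression tail (U * V) - tail U - tail V is bilinear in
    (U, V), after correction by the total masses. Replacing one argument F by
    H costs the convolution of g with the other law V. If V has increments
    asymptotic to kappa f, then the part of that convolution with V at most A
    is close to g itself, the middle part is negligible since g = O(f), and
    the part with V beyond x - A is (1 - K) tail V, a correction for the total
    masses, plus kappa f(x) times the difference of truncated means
    ([cvg_tail_convolutionB]); thus the cost is kappa (mean H - K mean F)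
    f(x). Applied once with V = H (kappa = K) and once with V = F (kappa = 1,
    weight K), and added to K^2 times the hypothesis on F, this gives 2 K
    (mean H - K mean F) + 2 K^2 mean F = 2 K mean H
    ([second_order_transfer]). *)

(** * Probabilities as real numbers *)

Section fine_probability.
Context d (T : measurableType d) (R : realType) (P : probability T R).
Implicit Types A B : set T.

Lemma fine_probabilityK A : measurable A -> (fine (P A))%:E = P A.
Proof. by move=> mA; rewrite fineK// fin_num_measure. Qed.

Lemma fine_probability_ge0 A : 0 <= fine (P A).
Proof. exact/fine_ge0/measure_ge0. Qed.

Lemma fine_probability_le1 A : measurable A -> fine (P A) <= 1.
Proof.
by move=> mA; rewrite -lee_fin fine_probabilityK// probability_le1.
Qed.

Lemma le_fine_probability A B : measurable A -> measurable B -> A `<=` B ->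
  fine (P A) <= fine (P B).
Proof.
move=> mA mB AB; apply: fine_le; rewrite ?fin_num_measure//.
by apply: le_measure; rewrite ?inE.
Qed.

Lemma fine_probabilityU A B : measurable A -> measurable B ->
  A `&` B = set0 -> fine (P (A `|` B)) = fine (P A) + fine (P B).
Proof.
by move=> mA mB AB0; rewrite measureU// fineD// fin_num_measure.
Qed.

Lemma fine_probabilityT : fine (P setT) = 1.
Proof. by rewrite probability_setT. Qed.

Lemma bounded_integrable (D : set T) (C : R) (phi : T -> R) : measurable D ->
  measurable_fun D phi -> (forall y, D y -> `|phi y| <= C) ->
  P.-integrable D (EFin \o phi).
Proof.
move=> mD mphi phiC; apply: measurable_bounded_integrable => //.
  by rewrite (le_lt_trans (probability_le1 _ _))// ltry.
exists C; split; first exact: num_real.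
by move=> M CM y Dy; apply: le_trans (phiC _ Dy) (ltW CM).
Qed.

End fine_probability.

Section distribution_functions.
Context {R : realType}.
Implicit Types (V : distr R) (x y t : R).

Lemma df_le V x y : x <= y -> df V x <= df V y.
Proof.
move=> xy; apply: le_fine_probability => //.
by apply: subset_itvl; rewrite bnd_simp.
Qed.

Lemma df_ge0 V x : 0 <= df V x.
Proof. exact: fine_probability_ge0. Qed.

Lemma df_le1 V x : df V x <= 1.
Proof. exact: fine_probability_le1. Qed.

Lemma tailE V x : tail V x = fine (V `]x, +oo[%classic).
Proof.
have := @fine_probabilityU _ _ _ V `]-oo, x]%classic `]x, +oo[%classic.
rewrite /tail /df itv_setU_setT fine_probabilityT => -> //.
  by rewrite addrAC subrr add0r.
by apply/disj_set2P; exact: disjoint_rays.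
Qed.

Lemma local_massE V t x : 0 <= t ->
  local_mass V t x = fine (V `]x, x + t]%classic).
Proof.
move=> t0; have xt : x <= x + t by rewrite lerDl.
apply/eqP; rewrite /local_mass /df subr_eq [eqbRHS]addrC -fine_probabilityU//.
  by rewrite -itv_bndbnd_setU// bnd_simp.
rewrite -subset0 => z /=; rewrite !in_itv/= => -[z1 /andP[/lt_geF]].
by rewrite z1.
Qed.

Lemma local_mass_tail V t x : local_mass V t x = tail V x - tail V (x + t).
Proof. by rewrite /local_mass /tail; ring. Qed.

Lemma local_mass_ge0 V t x : 0 <= t -> 0 <= local_mass V t x.
Proof. by move=> t0; rewrite subr_ge0 df_le// lerDl. Qed.

Lemma local_mass_le1 V t x : local_mass V t x <= 1.
Proof.
by rewrite /local_mass; have := df_ge0 V x; have := df_le1 V (x + t); lra.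
Qed.

Lemma local_mass_le V t u x y : y <= x -> x + t <= y + u ->
  local_mass V t x <= local_mass V u y.
Proof. by move=> yx xy; rewrite lerB// df_le. Qed.

Lemma measurable_df V : measurable_fun setT (df V).
Proof.
apply: nondecreasing_measurable => // x y.
exact: df_le.
Qed.

Lemma measurable_tail V : measurable_fun setT (tail V).
Proof. by apply: measurable_funB => //; exact: measurable_df. Qed.

Lemma measurable_local_mass V t : measurable_fun setT (local_mass V t).
Proof.
apply: measurable_funB; last exact: measurable_df.
by apply: (measurableT_comp (measurable_df V)); exact: measurable_funD.
Qed.

Lemma tail_ge0 V x : 0 <= tail V x.
Proof. by rewrite subr_ge0 df_le1. Qed.

Lemma tail_le1 V x : tail V x <= 1.
Proof. by rewrite /tail; have := df_ge0 V x; lra. Qed.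

Lemma cvg_df V : df V x @[x --> +oo] --> (1 : R).
Proof.
pose X : {mfun R >-> R} := HB.pack (idfun : R -> R)
  (isMeasurableFun.Build _ _ _ _ (idfun : R -> R) (@measurable_id _ _ setT)).
exact: (fine_cvg (cvg_cdfy1 (X : {RV V >-> R}))).
Qed.

End distribution_functions.

(** * Joint laws and convolutions *)

(** Turns a boolean comprehension into an event, so that events of the plane
    are measurable by composing comparisons. *)
Lemma measurable_setb d (T : measurableType d) (b : T -> bool) :
  measurable_fun setT b -> measurable [set z | b z].
Proof.
move=> mb; rewrite -[X in measurable X]setTI; have := mb measurableT [set true].
by apply.
Qed.

Section joint_probability.
Context {R : realType}.
Implicit Types (U V : distr R) (S : set (R * R)) (D : set R).

Definition joint U V S : R := fine ((U \x V)%E S).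

Lemma joint_xsection U V S : measurable S ->
  joint U V S = \int[U]_x fine (V (xsection S x)).
Proof.
move=> mS; rewrite /joint /Rintegral; congr fine; apply: eq_integral => x _ /=.
by rewrite fine_probabilityK//; exact: measurable_xsection.
Qed.

Lemma joint_setX U V S D : measurable S -> measurable D ->
  joint U V (S `&` (D `*` setT)) = \int[U]_(x in D) fine (V (xsection S x)).
Proof.
move=> mS mD; rewrite joint_xsection; last first.
  by apply: measurableI => //; exact: measurableX.
rewrite [RHS]Rintegral_mkcond; apply: eq_Rintegral => x _.
rewrite patchE; case: ifPn => xD.
- congr (fine (V _)); apply/seteqP; split => y /=; rewrite /xsection/= !inE/=.
  + by case.
  + by split=> //; split=> //; exact/set_mem.
- rewrite (_ : xsection _ _ = set0) ?measure0//.
  rewrite -subset0 => y /=; rewrite /xsection/= inE/= => -[_ [+ _]].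
  by move/mem_set; rewrite (negbTE xD).
Qed.

Lemma joint_swap U V S : measurable S ->
  joint U V S = joint V U [set z | S (z.2, z.1)].
Proof.
move=> mS; rewrite /joint; congr fine.
(* The two section integrals agree up to the name of the bound variable. *)
rewrite (@product_measure_unique _ _ _ _ _ U V (U \x^ V)%E)//.
by move=> A B mA mB; apply: product_measure2E.
Qed.

End joint_probability.

Ltac measurable_event := apply: measurable_setb;
  repeat (apply: measurable_and || apply: measurable_fun_ltr ||
          apply: measurable_fun_ler || apply: measurable_funD ||
          apply: measurable_funB) => //.

Section convolution.
Context {R : realType}.
Implicit Types (U V : distr R) (A t x : R).

Lemma tail_convolution_joint U V x :
  tail (convolution U V) x = joint U V [set z | x < z.1 + z.2].
Proof.
rewrite tailE /convolution /distribution /pushforward /joint/=.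
by congr (fine (_ _)); apply/seteqP; split=> z /=; rewrite in_itv/= andbT.
Qed.

Lemma local_mass_convolution_joint U V t x : 0 <= t ->
  local_mass (convolution U V) t x =
  joint U V [set z | x < z.1 + z.2 <= x + t].
Proof.
by move=> t0; rewrite local_massE.
Qed.

Lemma tail_convolutionC U V : tail (convolution U V) = tail (convolution V U).
Proof.
apply/funext => x; rewrite !tail_convolution_joint joint_swap; last first.
  by measurable_event.
by congr joint; apply/seteqP; split => z /=; rewrite addrC.
Qed.

(** The event whose probability is the error left by the two near parts.
    Keeping one threshold for both coordinates makes it symmetric in the two
    laws. *)
Definition both_large U V t A x : R :=
  joint U V [set z | [&& A < z.1, A < z.2 & x < z.1 + z.2 <= x + t]].

Lemma both_largeC U V t A x : both_large U V t A x = both_large V U t A x.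
Proof.
rewrite /both_large joint_swap; last by measurable_event.
congr joint; apply/seteqP; split => z /=.
  by rewrite addrC => /and3P[-> ->].
by rewrite addrC => /and3P[-> ->].
Qed.

Lemma joint_local_mass U V D t x : 0 <= t -> measurable D ->
  joint U V ([set z | x < z.1 + z.2 <= x + t] `&` (D `*` setT)) =
  \int[U]_(y in D) local_mass V t (x - y).
Proof.
move=> t0 mD; rewrite joint_setX//; last by measurable_event.
apply: eq_Rintegral => y _; rewrite local_massE//; congr (fine (V _)).
apply/seteqP; split=> z /=; rewrite /xsection/= inE/= in_itv/=.
  by move=> /andP[? ?]; apply/andP; split; lra.
by move=> /andP[? ?]; apply/andP; split; lra.
Qed.

Lemma joint_tail U V D x : measurable D ->
  joint U V ([set z | x < z.1 + z.2] `&` (D `*` setT)) =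
  \int[U]_(y in D) tail V (x - y).
Proof.
move=> mD; rewrite joint_setX//; last by measurable_event.
apply: eq_Rintegral => y _; rewrite tailE; congr (fine (V _)).
apply/seteqP; split=> z /=; rewrite /xsection/= inE/= in_itv/= andbT => ?; lra.
Qed.

(** When [A + A <= x] the summands cannot both be at most [A]. *)
Lemma local_mass_convolution U V t A x : 0 <= t -> A + A <= x ->
  local_mass (convolution U V) t x =
  \int[U]_(y in `]-oo, A]) local_mass V t (x - y) +
  \int[V]_(y in `]-oo, A]) local_mass U t (x - y) +
  both_large U V t A x.
Proof.
move=> t0 Ax; rewrite local_mass_convolution_joint//.
rewrite -!joint_local_mass// (@joint_swap _ V U); last first.
  apply: measurableI; first by measurable_event.
  exact: measurableX.
pose E1 := [set z : R * R | z.1 <= A] `&` [set z | x < z.1 + z.2 <= x + t].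
pose E2 := [set z : R * R | z.2 <= A] `&` [set z | x < z.1 + z.2 <= x + t].
pose E3 := [set z : R * R | [&& A < z.1, A < z.2 & x < z.1 + z.2 <= x + t]].
have mE1 : measurable E1 by apply: measurableI; measurable_event.
have mE2 : measurable E2 by apply: measurableI; measurable_event.
have mE3 : measurable E3 by measurable_event.
transitivity (joint U V ((E1 `|` E2) `|` E3)).
  congr joint; rewrite /E1 /E2 /E3; apply/seteqP; split => z /=.
    move=> h; case: (leP z.1 A) => z1; first by left; left.
    case: (leP z.2 A) => z2; first by left; right.
    by right; rewrite /= ?z1 ?z2.
  by case=> [[|]|]; [case|case|move/and3P => -[]].
rewrite /joint fine_probabilityU//; last 2 first.
- exact: measurableU.
- by rewrite -subset0 /E1 /E2 /E3 => z /= -[[] [h _] /and3P[h1 h2 _]]; lra.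
rewrite fine_probabilityU//; last first.
  by rewrite -subset0 /E1 /E2 /E3 => z /= -[[z1 /andP[z2 _]] [z3 _]]; lra.
by congr (_ + _ + _); congr joint; rewrite ?/E1 ?/E2 ?/E3;
  apply/seteqP; split => z /=; rewrite in_itv/= 1?[z.2 + _]addrC; tauto.
Qed.

(** The three terms correspond to the position of the second summand with
    respect to [A] and [x - A]. In the last one the integration is over the
    first summand: given its value z, the second must exceed both [x - z] and
    [x - A]. *)
Lemma tail_convolution U V A x : A + A <= x ->
  tail (convolution U V) x =
  \int[V]_(y in `]-oo, A]) tail U (x - y) +
  \int[V]_(y in `]A, x - A]) tail U (x - y) +
  \int[U]_z tail V (x - Num.min z A).
Proof.
move=> Ax; rewrite tail_convolution_joint joint_swap; last by measurable_event.
rewrite -!joint_tail//.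
pose E1 := [set z : R * R | z.1 <= A] `&` [set z | x < z.1 + z.2].
pose E2 := [set z : R * R | A < z.1 <= x - A] `&` [set z | x < z.1 + z.2].
pose E3 := [set z : R * R | x - A < z.1] `&` [set z | x < z.1 + z.2].
have mE1 : measurable E1 by apply: measurableI; measurable_event.
have mE2 : measurable E2 by apply: measurableI; measurable_event.
have mE3 : measurable E3 by apply: measurableI; measurable_event.
have -> : \int[U]_z tail V (x - Num.min z A) = joint V U E3.
  have swapE3 : [set z | E3 (z.2, z.1)] =
      [set z : R * R | (x - A < z.2) && (x < z.2 + z.1)].
    by apply/seteqP; split => z /=; [case=> /= -> -> | move=> /andP].
  rewrite joint_swap// swapE3 joint_xsection; last by measurable_event.
  apply: eq_Rintegral => z _; rewrite tailE; congr (fine (V _)).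
  apply/seteqP; split=> y /=; rewrite /xsection/= in_itv/= andbT inE/=.
    by move=> h; apply/andP; split; move: h; case: (leP z A) => ? ?; lra.
  by move=> /andP[h1 h2]; case: (leP z A) => ?; lra.
transitivity (joint V U ((E1 `|` E2) `|` E3)).
  congr joint; rewrite /E1 /E2 /E3; apply/seteqP; split => z /=.
    rewrite addrC => h; case: (leP z.1 A) => z1; first by left; left.
    case: (leP z.1 (x - A)) => z2.
      by left; right; split => //; apply/andP.
    by right.
  by rewrite [z.2 + _]addrC => -[[[]|[]]|[]].
rewrite /joint fine_probabilityU//; last 2 first.
- exact: measurableU.
- rewrite -subset0 /E1 /E2 /E3 => z /=.
  by move=> -[[[h1 _]|[/andP[h1 h2] _]] [h3 _]]; lra.
rewrite fine_probabilityU//; last first.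
  by rewrite -subset0 /E1 /E2 /E3 => z /= -[[z1 _] [/andP[z2 _] _]]; lra.
by congr (_ + _ + _); congr joint; rewrite ?/E1 ?/E2 ?/E3;
  apply/seteqP; split => z /=; rewrite in_itv/=; tauto.
Qed.

Lemma middle_le_both_large U V t A x : 0 <= t ->
  \int[V]_(y in `]A, x - A]) local_mass U t (x - y) <= both_large U V t A x.
Proof.
move=> t0; rewrite -joint_local_mass// both_largeC.
apply: le_fine_probability.
- apply: measurableI; first by measurable_event.
  exact: measurableX.
- by measurable_event.
- move=> z /= [/andP[h1 h2] [+ _]]; rewrite in_itv/= => /andP[h3 h4].
  by rewrite h1 h2 h3/= andbT; lra.
Qed.

(** A window meeting the region beyond [A + t] starts beyond [A], where the
    domination holds and the full window of [U] is counted; this is why the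
    threshold drops by [t]. *)
Lemma both_large_le U U' V t C A x : 0 <= t -> 0 <= C ->
  (forall z, A <= z -> local_mass U' t z <= C * local_mass U t z) ->
  both_large U' V t (A + t) x <= C * both_large U V t A x.
Proof.
move=> t0 C0 UU'; rewrite both_largeC [both_large U V _ _ _]both_largeC.
have mE B : measurable [set z : R * R |
    [&& B < z.1, B < z.2 & x < z.1 + z.2 <= x + t]] by measurable_event.
have intE (W : distr R) B : V.-integrable setT (EFin \o (fun y : R =>
    fine (W (xsection [set z : R * R |
      [&& B < z.1, B < z.2 & x < z.1 + z.2 <= x + t]] y)) : R)).
  apply: (@bounded_integrable _ _ _ _ _ 1) => //.
    apply: (@measurableT_comp _ _ _ _ _ _ fine); first by [].
    exact: (measurable_fun_xsection W (mE B)).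
  move=> y _; rewrite ger0_norm ?fine_probability_ge0//.
  by apply: fine_probability_le1; exact: measurable_xsection.
rewrite /both_large !joint_xsection// -RintegralZl//.
apply: le_Rintegral => //.
  have := integrableZl measurableT C (intE U A).
  by apply: eq_integrable.
move=> y _.
have sectionE B : xsection [set z : R * R |
      [&& B < z.1, B < z.2 & x < z.1 + z.2 <= x + t]] y =
    [set w | [&& B < y, B < w & x < y + w <= x + t]].
  by apply/seteqP; split => w /=; rewrite /xsection/= inE.
have msection B : measurable [set w | [&& B < y, B < w & x < y + w <= x + t]].
  by rewrite -sectionE; apply: measurable_xsection.
rewrite !sectionE.
have [xyA|Axy] := ltP (x - y) A.
  rewrite (_ : [set _ | _] = set0) ?measure0/=.
    by rewrite mulr_ge0 ?fine_probability_ge0.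
  by rewrite -subset0 => w /= /and3P[_ h1 /andP[h2 h3]]; lra.
apply: (@le_trans _ _ (fine (U' (if A < y then `]x - y, x - y + t]%classic
                                          else set0)))).
  apply: le_fine_probability.
  - exact: msection.
  - by case: ifP.
  - move=> w /= /and3P[h1 h2 /andP[h3 h4]].
    rewrite ifT; last lra.
    by rewrite /= in_itv/=; apply/andP; split; lra.
case: ifPn => Ay; last first.
  by rewrite measure0 mulr_ge0 ?fine_probability_ge0.
rewrite -local_massE//; apply: le_trans (UU' _ Axy) _.
rewrite local_massE//; apply: ler_wpM2l => //.
apply: le_fine_probability => //.
  by have := msection A; rewrite Ay.
move=> w /=; rewrite in_itv/= => /andP[h1 h2].
by apply/and3P; split; lra.
Qed.

End convolution.

(** * Limits at infinity *)

Section limits_at_infinity.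
Context {R : realType}.
Implicit Types (q r : R -> R) (l c : R).

(** Serves to let a cut-off, on which [r] and [c] depend, tend to infinity after
    [x]. *)
Lemma cvg_by_approximation q l :
  (forall e, 0 < e -> exists r c, [/\ r x @[x --> +oo] --> c, `|c - l| <= e &
    \forall x \near +oo, `|q x - r x| <= e]) ->
  q x @[x --> +oo] --> l.
Proof.
move=> qP; apply/cvgrPdistC_le => e e0.
have e30 : 0 < e / 3 by rewrite divr_gt0.
have [r [c [rc cl qr]]] := qP _ e30.
have {}rc : \forall x \near +oo, `|r x - c| <= e / 3.
  by move/cvgrPdistC_le : rc; exact.
near=> x.
have h1 : `|r x - c| <= e / 3 by near: x.
have h2 : `|q x - r x| <= e / 3 by near: x.
move: h1 h2 cl; rewrite !ler_norml => /andP[? ?] /andP[? ?] /andP[? ?].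
by apply/andP; split; lra.
Unshelve. all: by end_near. Qed.

Lemma cvg_near_eq q r l : (\forall x \near +oo, r x = q x) ->
  r x @[x --> +oo] --> l -> q x @[x --> +oo] --> l.
Proof. by move=> rq; apply: cvg_trans; exact: near_eq_cvg. Qed.

Lemma cvg_eventually_bounded q l : q x @[x --> +oo] --> l ->
  \forall x \near +oo, `|q x| <= `|l| + 1.
Proof. by move=> ql; apply: (cvgr_norm_le _ ql); rewrite ltrDl. Qed.

Lemma near_pinfty_shift (P : R -> Prop) a :
  (\forall x \near +oo, P x) -> \forall x \near +oo, P (x + a).
Proof. exact: (@cvg_addrr R a P). Qed.

Lemma near_pinfty_ray (P : R -> Prop) :
  (\forall x \near +oo, P x) -> exists A, forall x, A <= x -> P x.
Proof.
by move=> [A [_ AP]]; exists (A + 1) => x Ax; apply: AP; lra.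
Qed.

Lemma half_line_ae (V : distr R) :
  on_half_line V -> {ae V, forall y : R, 0 <= y}.
Proof.
move=> V0; exists `]-oo, 0[%classic; split => //.
  rewrite -setCitvr; rewrite probability_setC//.
  by rewrite V0 subee.
by move=> y /= /negP; rewrite -ltNge in_itv.
Qed.

(** The hypotheses are required at nonnegative points only: negative points
    form a null set of a law of the half-line. *)
Lemma cvg_Rintegral_dominated (V : distr R) (D : set R) (psi : R -> R -> R)
    (phi h : R -> R) :
  on_half_line V -> measurable D ->
  (forall x, measurable_fun D (psi x)) -> measurable_fun D phi ->
  (forall y, D y -> 0 <= y -> psi x y @[x --> +oo] --> phi y) ->
  V.-integrable D (EFin \o h) ->
  (\forall x \near +oo, forall y, D y -> 0 <= y -> `|psi x y| <= h y) ->
  \int[V]_(y in D) psi x y @[x --> +oo] --> \int[V]_(y in D) phi y.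
Proof.
move=> V0 mD mpsi mphi psiphi ih psih.
have V0ae := half_line_ae V0.
apply/cvg_pinftyP => u uoo.
have [N _ Nh] : \forall n \near \oo,
  forall y, D y -> 0 <= y -> `|psi (u n) y| <= h y := uoo _ psih.
rewrite -(cvg_shiftn N).
have [|||||iphi _ +] := @dominated_convergence _ _ R V D mD
  (fun n => EFin \o psi (u (n + N)%N)) (EFin \o phi) (EFin \o h).
- by move=> n; exact/measurable_EFinP.
- exact/measurable_EFinP.
- apply: filterS V0ae => y y0 Dy; apply/cvg_EFin; first by near=> n.
  rewrite (cvg_shiftn N (fun n => psi (u n) y)).
  by have /cvg_pinftyP/(_ _ uoo) := psiphi y Dy y0.
- exact: ih.
- apply: filterS V0ae => y y0 n Dy; rewrite /= lee_fin.
  by apply: Nh => //=; rewrite leq_addl.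
- rewrite -[X in _ --> X -> _]fineK; last exact: integrable_fin_num.
  by move/fine_cvg.
Unshelve. all: by end_near. Qed.

End limits_at_infinity.

(** * Local long tails *)

Section local_long_tails.
Context {R : realType}.
Implicit Types (F V : distr R) (c kappa t y : R).

(** Uniform convergence in the shift, freed from the uniform structure on
    functions. *)
Lemma local_long_tailedP t V : local_long_tailed t V <->
  forall e, 0 < e -> \forall x \near +oo, forall y, 0 <= y <= 1 ->
    `|local_mass V t (x + y) / local_mass V t x - 1| <= e.
Proof.
split=> [VL e e0|VP].
- have /VL : nbhs ((fun=> 1) : {uniform` `[0, 1]%classic -> R})
      [set h : R -> R | forall y, 0 <= y <= 1 -> `|h y - 1| <= e].
    apply/uniform_nbhs; exists [set z : R * R | ball z.1 e z.2].
    split; first exact: (entourage_ball _ (PosNum e0)).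
    move=> h hE y y01; have /hE : `[0, 1]%classic y by rewrite /= in_itv.
    by rewrite /ball/= distrC => /ltW.
  by [].
- move=> P /uniform_nbhs[E [/=]].
  rewrite -entourage_from_ballE => -[e /= e0 eE] EP.
  have e20 : 0 < e / 2 by rewrite divr_gt0.
  apply: filterS (VP _ e20) => x xe; apply: EP => y.
  rewrite /= in_itv/= => y01; apply: eE => /=.
  rewrite /ball/= distrC; apply: le_lt_trans (xe _ y01) _.
  by rewrite ltr_pdivrMr// ltr_pMr// ltr1n.
Qed.

(** The limit 1 at the shift 0 is that of u / u, which is 0 when u = 0. *)
Lemma near_local_mass_neq0 t V : local_long_tailed t V ->
  \forall x \near +oo, local_mass V t x != 0.
Proof.
have e0 : 0 < 2^-1 :> R by rewrite invr_gt0.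
move/local_long_tailedP => /(_ _ e0); apply: filterS => x /(_ 0).
rewrite lexx ler01 => /(_ isT); apply: contraTN => /eqP ->.
by rewrite invr0 mulr0 sub0r normrN1 -ltNge invf_lt1 ?ltr1n.
Qed.

Lemma local_long_tailed_shift t V y : local_long_tailed t V -> 0 <= y ->
  local_mass V t (x + y) / local_mass V t x @[x --> +oo] --> (1 : R).
Proof.
move=> VL y0.
have V0 := near_local_mass_neq0 VL.
have shift1 s : 0 <= s <= 1 ->
    local_mass V t (x + s) / local_mass V t x @[x --> +oo] --> (1 : R).
  move=> s01; apply/cvgrPdistC_le => e e0.
  by move/local_long_tailedP : VL => /(_ _ e0); apply: filterS => x; exact.
pose s := y / (Num.truncn y).+1%:R.
have s01 : 0 <= s <= 1.
  rewrite divr_ge0//= ler_pdivrMr// mul1r ltW//.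
  exact: truncnS_gt.
have -> : y = s *+ (Num.truncn y).+1 by rewrite -mulr_natr divfK.
elim: (Num.truncn y).+1 => [|n IHn].
  apply: cvg_near_eq (cvg_cst (1 : R)).
  by apply: filterS V0 => x ?; rewrite mulr0n addr0 divff.
rewrite -[X in _ --> X]mulr1.
have := shift1 _ s01; rewrite -(cvg_shiftr (s *+ n)) => /cvgM/(_ IHn).
apply: cvg_near_eq.
have := near_pinfty_shift (s *+ n) V0; apply: filterS => x Vx /=.
by rewrite mulrSr addrA mulrA divfK.
Qed.

Lemma local_mass_add V t s x :
  local_mass V (t + s) x = local_mass V t x + local_mass V s (x + t).
Proof. by rewrite /local_mass addrA; ring. Qed.

Lemma cvg_local_mass_mulrn V s n : local_long_tailed s V -> 0 <= s ->
  local_mass V (s *+ n) x / local_mass V s x @[x --> +oo] --> (n%:R : R).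
Proof.
move=> VL s0; elim: n => [|n IHn].
  apply: cvg_near_eq (cvg_cst (0 : R)); near=> x.
  by rewrite mulr0n /local_mass addr0 subrr mul0r.
rewrite -natr1; under eq_cvg do rewrite mulrSr local_mass_add mulrDl.
by apply: cvgD IHn _; apply: local_long_tailed_shift => //; exact: mulrn_wge0.
Unshelve. all: by end_near. Qed.

(** Local long tails at every width make the local mass proportional to the
    width: subdividing gives it for commensurable widths, monotonicity in the
    width for the others. *)
Lemma cvg_local_mass_width V t : (forall s, 0 < s -> local_long_tailed s V) ->
  0 < t -> local_mass V t x / local_mass V 1 x @[x --> +oo] --> t.
Proof.
move=> VL t0; apply: cvg_by_approximation => e e0.
pose n := (Num.truncn (2 / e)).+1; pose s : R := n%:R^-1.
have s0 : 0 < s by rewrite invr_gt0.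
have sn : s *+ n = 1 by rewrite -mulr_natr mulVf ?pnatr_eq0.
have s2e : 2 * s <= e.
  by rewrite ler_pdivrMr// mulrC -ler_pdivrMr// ltW// truncnS_gt.
(* [t] lies between [s *+ m] and [s *+ m.+1], which differ by s <= e / 2. *)
pose m := Num.truncn (t / s).
have ts0 : 0 <= t / s by rewrite divr_ge0// ltW.
have mst : s *+ m <= t by rewrite -mulr_natl -ler_pdivlMr// truncn_le.
have tms : t <= s *+ m.+1.
  by rewrite -mulr_natl -ler_pdivrMr// ltW// truncnS_gt.
have V0 := near_local_mass_neq0 (VL _ s0).
have sV_cvg k := @cvg_local_mass_mulrn V s k (VL _ s0) (ltW s0).
have sV : local_mass V s x / local_mass V 1 x @[x --> +oo] --> s.
  have n0 : n%:R != 0 :> R by rewrite pnatr_eq0.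
  have := cvgV n0 (sV_cvg n).
  move=> /(_ _); apply: cvg_near_eq; near=> x.
  by rewrite sn /= invf_div.
have msV k : local_mass V (s *+ k) x / local_mass V 1 x @[x --> +oo] --> s *+ k.
  have := cvgM (sV_cvg k) sV => /(_ _).
  rewrite mulr_natl; apply: cvg_near_eq.
  by apply: filterS V0 => x Vx /=; rewrite mulrA divfK.
exists (fun x => local_mass V (s *+ m) x / local_mass V 1 x), (s *+ m).
split; first exact: msV.
  by rewrite distrC ger0_norm ?subr_ge0//; move: tms; rewrite mulrSr; lra.
have : `|s *+ m.+1 - s *+ m| < e.
  by rewrite mulrSr addrAC subrr add0r gtr0_norm//; lra.
move/(cvgr_norm_le _ (cvgB (msV m.+1) (msV m))).
apply: filterS => x; apply: le_trans => /=.
have V1 : 0 <= (local_mass V 1 x)^-1 by rewrite invr_ge0 local_mass_ge0.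
rewrite -!mulrBl !normrM ler_wpM2r// !ger0_norm ?subr_ge0.
- by rewrite lerB// local_mass_le// lerD2l.
- by rewrite local_mass_le// lerD2l// mulrSr lerDl ltW.
- by rewrite local_mass_le// lerD2l.
Unshelve. all: by end_near. Qed.
End local_long_tails.

(** * Increments proportional to those of a reference law *)

Section proportional_increments.
Context {R : realType}.
Implicit Types (F U V : distr R) (c kappa t y : R).

(** The masses that [V] gives to windows are asymptotically [kappa] times the
    widths of the windows, in units of the mass that the reference [F] gives
    to the unit window. Including all shifts [y] encodes long-tailedness. *)
Definition proportional_increments F kappa V := forall t y, 0 < t ->
  local_mass V t (x + y) / local_mass F 1 x @[x --> +oo] --> kappa * t.

Lemma proportional_increments_self F :
  (forall t, 0 < t -> local_long_tailed t F) -> proportional_increments F 1 F.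
Proof.
move=> FL.
have incr t y : 0 < t -> 0 <= y ->
    local_mass F t (x + y) / local_mass F 1 x @[x --> +oo] --> t.
  move=> t0 y0.
  have := cvgM (local_long_tailed_shift (FL _ t0) y0)
    (cvg_local_mass_width FL t0) => /(_ _).
  rewrite mul1r; apply: cvg_near_eq.
  apply: filterS (near_local_mass_neq0 (FL _ t0)) => x Fx /=.
  by rewrite mulrA divfK.
move=> t y t0; rewrite mul1r; have [y0|y0] := leP 0 y; first exact: incr.
have Ny0 : 0 <= - y by rewrite oppr_ge0 ltW.
rewrite -(cvg_shiftr (- y)).
have ratio1 := incr 1 (- y) ltr01 Ny0.
have := cvgV (oner_neq0 R) ratio1 => /(_ _) ratioV.
have := cvgM (cvg_local_mass_width FL t0) ratioV => /(_ _).
rewrite invr1 mulr1; apply: cvg_near_eq.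
apply: filterS (near_local_mass_neq0 (FL _ ltr01)) => x Fx /=.
by rewrite invf_div mulrA divfK// subrK.
Qed.

Section reference.
Variable F : distr R.
Hypothesis F1 : proportional_increments F 1 F.

Let f := local_mass F 1.

Lemma cvg_reference_shift y : f (x + y) / f x @[x --> +oo] --> (1 : R).
Proof. by have := F1 y ltr01; rewrite mulr1. Qed.

Lemma near_reference_gt0 : \forall x \near +oo, 0 < f x.
Proof.
have h := cvg_reference_shift 0.
near=> x; rewrite lt_neqAle local_mass_ge0// andbT eq_sym.
suff : f (x + 0) / f x != 0.
  by apply: contraNneq => ->; rewrite invr0 mulr0.
by near: x; apply: cvgr_neq0 h _; exact: oner_neq0.
Unshelve. all: by end_near. Qed.

Lemma cvg_ratio_shift (phi : R -> R) c y : phi x / f x @[x --> +oo] --> c ->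
  phi (x + y) / f x @[x --> +oo] --> c.
Proof.
rewrite -(cvg_shiftr y) => phic.
have := cvgM phic (cvg_reference_shift y) => /(_ _).
rewrite mulr1; apply: cvg_near_eq.
apply: filterS (near_pinfty_shift y near_reference_gt0) => x fx /=.
by rewrite mulrA divfK// gt_eqF.
Qed.

Lemma cvg_ratio_le (phi : R -> R) c : phi x / f x @[x --> +oo] --> c ->
  \forall x \near +oo, `|phi x| <= (`|c| + 1) * f x.
Proof.
move=> /cvg_eventually_bounded phiC.
near=> x; have fx : 0 < f x by near: x; exact: near_reference_gt0.
rewrite -ler_pdivrMr//; have : `|phi x / f x| <= `|c| + 1 by near: x.
by rewrite normrM normfV (gtr0_norm fx).
Unshelve. all: by end_near. Qed.

Lemma cvg_increments V kappa t y :
  0 <= t -> proportional_increments F kappa V ->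
  local_mass V t (x + y) / f x @[x --> +oo] --> kappa * t.
Proof.
rewrite le_eqVlt => /predU1P[<- _|t0 VF]; last exact: VF.
rewrite mulr0; apply: cvg_near_eq (cvg_cst (0 : R)); near=> x.
by rewrite /local_mass addr0 subrr mul0r.
Unshelve. all: by end_near. Qed.

(** All unit windows starting in [x - A, x] lie in the single window of width
    [A + 1] starting at [x - A]. *)
Lemma near_reference_back A : 0 <= A ->
  \forall x \near +oo, forall y, 0 <= y <= A -> f (x - y) <= (A + 2) * f x.
Proof.
move=> A0; have A1 : 0 <= A + 1 by rewrite addr_ge0.
have /= := cvg_ratio_le (cvg_increments (- A) A1 F1).
apply: filterS => x; rewrite mul1r !ger0_norm ?local_mass_ge0// => fA y.
move=> /andP[y0 yA].
rewrite (_ : A + 2 = A + 1 + 1); last by ring.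
by apply: le_trans fA; apply: local_mass_le; lra.
Qed.

(** The quotient phi(x - y) / f(x) tends to [c] at fixed [y], and
    [near_reference_back] bounds it for y in [0, A]. *)
Lemma cvg_near_part V (phi : R -> R) (M c A : R) : on_half_line V -> 0 <= A ->
  measurable_fun setT phi -> (forall z, `|phi z| <= M) ->
  phi x / f x @[x --> +oo] --> c ->
  (\int[V]_(y in `]-oo, A]) phi (x - y)) / f x @[x --> +oo] --> c * df V A.
Proof.
move=> V0 A0 mphi phiM phic.
rewrite /df -(Rintegral_cst V)//.
have [B fphiB] := near_pinfty_ray (cvg_ratio_le phic).
have mphix x : measurable_fun `]-oo, A] (fun y => phi (x - y)).
  apply: measurable_funTS; apply: measurableT_comp => //.
  exact: measurable_funB.
pose C := (`|c| + 1) * (A + 2).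
have : \int[V]_(y in `]-oo, A]) (phi (x - y) / f x) @[x --> +oo] -->
    \int[V]_(_ in `]-oo, A]) c.
  apply: (@cvg_Rintegral_dominated _ V `]-oo, A]%classic
    (fun x y => phi (x - y) / f x) (cst c) (cst C)) => //.
  - by move=> x; apply: measurable_funM.
  - by move=> y _ _; exact: cvg_ratio_shift.
  - by apply: (@bounded_integrable _ _ _ V _ `|C|).
  near=> x => y; rewrite /= in_itv/= => yA y0.
  have fx : 0 < f x by near: x; exact: near_reference_gt0.
  rewrite normrM normfV (gtr0_norm fx) ler_pdivrMr//.
  apply: le_trans (fphiB _ _) _.
    have : B + A <= x by near: x; apply: nbhs_pinfty_ge; exact: num_real.
    by lra.
  rewrite /C -mulrA ler_wpM2l//.
  have : forall y, 0 <= y <= A -> f (x - y) <= (A + 2) * f x.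
    by near: x; exact: near_reference_back.
  by apply; rewrite y0.
apply: cvg_near_eq; near=> x; rewrite RintegralZr//.
by apply: (@bounded_integrable _ _ _ V _ M).
Unshelve. all: by end_near. Qed.

Lemma truncation_integrable U (A : R) : finite_mean U ->
  U.-integrable setT (EFin \o (fun z => Num.min z A)).
Proof.
move=> U1; apply: (@le_integrable _ _ _ U setT measurableT _
  (EFin \o (fun z : R => `|z| + `|A|))).
- by apply/measurable_EFinP; exact: measurable_minr.
- move=> z _ /=; rewrite lee_fin (ger0_norm (addr_ge0 _ _))//.
  by case: (leP z A) => _; rewrite ?lerDl ?lerDr.
- have := integrableD measurableT (integrable_norm U1)
    (finite_measure_integrable_cst U `|A| measurableT).
  exact.
Qed.

Lemma cvg_truncated_mean U : on_half_line U -> finite_mean U ->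
  \int[U]_z Num.min z A @[A --> +oo] --> mean U.
Proof.
move=> U0 U1; rewrite /mean unlock.
apply: (@cvg_Rintegral_dominated _ U setT (fun A z => Num.min z A) id
  (fun z => `|z|)) => //.
- by move=> A; exact: measurable_minr.
- move=> z _ z0; apply: cvg_near_eq (cvg_cst z).
  near=> A; rewrite min_l//; near: A.
- exact: integrable_norm.
- near=> A => z _ z0; have A0 : 0 <= A.
    by near: A; apply: nbhs_pinfty_ge; exact: num_real.
  rewrite !ger0_norm//; first by rewrite ge_min lexx.
  by rewrite le_min z0.
Unshelve. all: by end_near. Qed.

(** The numerator integrates the mass of (x - min (z, A), x], a window of
    width min (z, A) inside (x - A, x]. *)
Lemma cvg_min_part U V kappa (A : R) : on_half_line U -> finite_mean U ->
  0 <= A -> proportional_increments F kappa V ->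
  (\int[U]_z tail V (x - Num.min z A) - tail V x) / f x @[x --> +oo] -->
  kappa * \int[U]_z Num.min z A.
Proof.
move=> U0 U1 A0 VF.
have mtail (x : R) :
    measurable_fun setT (fun z : R => tail V (x - Num.min z A)).
  apply: (measurableT_comp (measurable_tail V)).
  by apply: measurable_funB => //; exact: measurable_minr.
rewrite -RintegralZl//; last exact: truncation_integrable.
have tailB x z : tail V (x - z) - tail V x = local_mass V z (x - z).
  by rewrite local_mass_tail subrK.
have : \int[U]_z ((tail V (x - Num.min z A) - tail V x) / f x) @[x --> +oo] -->
    \int[U]_z (kappa * Num.min z A).
  apply: (@cvg_Rintegral_dominated _ U setT
    (fun x z => (tail V (x - Num.min z A) - tail V x) / f x)
    (fun z => kappa * Num.min z A) (cst (`|kappa * A| + 1))) => //.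
  - by move=> x; apply: measurable_funM => //; apply: measurable_funB.
  - by apply: measurable_funM => //; exact: measurable_minr.
  - move=> z _ z0; under eq_cvg do rewrite tailB.
    by apply: cvg_increments VF; rewrite le_min z0.
  - by apply: (@bounded_integrable _ _ _ U _ `|(`|kappa * A| + 1)|).
  near=> x => z _ z0.
  have fx : 0 < f x by near: x; exact: near_reference_gt0.
  have zA : 0 <= Num.min z A <= A by rewrite le_min z0 A0 ge_min lexx orbT.
  have : `|local_mass V A (x - A) / f x| <= `|kappa * A| + 1.
    by near: x; exact: (cvg_eventually_bounded (cvg_increments (- A) A0 VF)).
  apply: le_trans; rewrite tailB.
  have [m0 mA] := andP zA.
  rewrite !ger0_norm; last 2 first.
  - by apply: divr_ge0; [exact: local_mass_ge0 | exact: ltW].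
  - by apply: divr_ge0; [exact: local_mass_ge0 | exact: ltW].
  rewrite ler_pM2r ?invr_gt0//; apply: local_mass_le; lra.
apply: cvg_near_eq; near=> x.
have itail : U.-integrable setT (EFin \o (fun z => tail V (x - Num.min z A))).
  apply: (@bounded_integrable _ _ _ U _ 1) => // z _.
  by rewrite ger0_norm ?tail_ge0 ?tail_le1.
have icst : U.-integrable setT (EFin \o (fun=> tail V x)).
  exact: finite_measure_integrable_cst.
rewrite RintegralZr//; last first.
  by have := integrableB measurableT itail icst; exact.
rewrite RintegralB// Rintegral_cst//.
by have -> := fine_probabilityT U; rewrite mulr1.
Unshelve. all: by end_near. Qed.

End reference.
End proportional_increments.

(** * Negligibility of two large summands *)

Section both_summands_large.
Context {R : realType}.
Variable F : distr R.
Hypothesis F1 : proportional_increments F 1 F.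
Implicit Types (U V : distr R) (c kappa lambda t y : R).

Let f := local_mass F 1.

Definition both_large_negligible t U V := forall e, 0 < e ->
  \forall A \near +oo, \forall x \near +oo, both_large U V t A x <= e * f x.

Lemma both_large_negligibleC t U V :
  both_large_negligible t U V -> both_large_negligible t V U.
Proof.
move=> UV e e0; apply: filterS (UV e e0) => A; apply: filterS => x.
by rewrite both_largeC.
Qed.

Lemma cvg_near_parts U V kappa lambda t A : on_half_line U -> on_half_line V ->
  proportional_increments F kappa U -> proportional_increments F lambda V ->
  0 < t -> 0 <= A ->
  (\int[U]_(y in `]-oo, A]) local_mass V t (x - y) +
   \int[V]_(y in `]-oo, A]) local_mass U t (x - y)) / f x @[x --> +oo] -->
  lambda * t * df U A + kappa * t * df V A.
Proof.
move=> U0 V0 UF VF t0 A0.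
have near_part W W' nu : on_half_line W -> proportional_increments F nu W' ->
    (\int[W]_(y in `]-oo, A]) local_mass W' t (x - y)) / f x @[x --> +oo] -->
    nu * t * df W A.
  move=> W0 WF; apply: (@cvg_near_part _ _ _ _ _ 1) => //.
  - exact: measurable_local_mass.
  - by move=> z; rewrite ger0_norm ?local_mass_le1// local_mass_ge0// ltW.
  - have := WF t 0 t0; under eq_cvg do rewrite addr0; exact.
under eq_cvg do rewrite mulrDl.
by apply: cvgD; exact: near_part.
Qed.

Lemma cvg_near_parts_limit U V kappa lambda t :
  lambda * t * df U A + kappa * t * df V A @[A --> +oo] -->
  (kappa + lambda) * t.
Proof.
rewrite (_ : (kappa + lambda) * t = lambda * t * 1 + kappa * t * 1).
  2: by ring.
by apply: cvgD; apply: cvgMl_tmp; exact: cvg_df.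
Qed.

Lemma local_mass_convolution_cvg U V kappa lambda t :
  on_half_line U -> on_half_line V ->
  proportional_increments F kappa U -> proportional_increments F lambda V ->
  0 < t -> both_large_negligible t U V ->
  local_mass (convolution U V) t x / f x @[x --> +oo] --> (kappa + lambda) * t.
Proof.
move=> U0 V0 UF VF t0 UV; apply: cvg_by_approximation => e e0.
have /cvgrPdistC_le/(_ _ e0) near_l := @cvg_near_parts_limit U V kappa lambda t.
have [A [A0 lA UVA]] : exists A, [/\ 0 <= A,
    `|lambda * t * df U A + kappa * t * df V A - (kappa + lambda) * t| <= e &
    \forall x \near +oo, both_large U V t A x <= e * f x].
  near +oo_(R) => A; exists A; split; near: A => //.
  - by apply: nbhs_pinfty_ge; exact: num_real.
  - exact: UV.
eexists; exists (lambda * t * df U A + kappa * t * df V A); split => //.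
  exact: cvg_near_parts.
near=> x; have fx : 0 < f x by near: x; exact: near_reference_gt0.
have AAx : A + A <= x by near: x; apply: nbhs_pinfty_ge; exact: num_real.
rewrite -mulrBl (local_mass_convolution _ _ (ltW t0) AAx).
rewrite addrAC subrr add0r ger0_norm; last first.
  by rewrite divr_ge0// ?(ltW fx)// fine_probability_ge0.
by rewrite ler_pdivrMr//; near: x.
Unshelve. all: by end_near. Qed.

(** The near parts exhaust the limit as [A] grows, which leaves no mass for two
    large summands. *)
Lemma local_mass_convolution_negligible U V kappa lambda t :
  on_half_line U -> on_half_line V ->
  proportional_increments F kappa U -> proportional_increments F lambda V ->
  0 < t ->
  local_mass (convolution U V) t x / f x @[x --> +oo] -->
    (kappa + lambda) * t ->
  both_large_negligible t U V.
Proof.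
move=> U0 V0 UF VF t0 UV e e0.
have e20 : 0 < e / 2 by rewrite divr_gt0.
have /cvgrPdistC_le/(_ _ e20) near_l :=
  @cvg_near_parts_limit U V kappa lambda t.
near=> A; have A0 : 0 <= A by near: A; apply: nbhs_pinfty_ge; exact: num_real.
have lA :
    `|lambda * t * df U A + kappa * t * df V A - (kappa + lambda) * t| <= e / 2.
  by near: A.
have parts := cvg_near_parts U0 V0 UF VF t0 A0.
have := cvgB UV parts => /(_ _) /cvgrPdistC_le/(_ _ e20) Bl.
near=> x; have fx : 0 < f x by near: x; exact: near_reference_gt0.
have AAx : A + A <= x by near: x; apply: nbhs_pinfty_ge; exact: num_real.
rewrite -ler_pdivrMr//.
have : `|local_mass (convolution U V) t x / f x -
    (\int[U]_(y in `]-oo, A]) local_mass V t (x - y) +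
     \int[V]_(y in `]-oo, A]) local_mass U t (x - y)) / f x -
    ((kappa + lambda) * t - (lambda * t * df U A + kappa * t * df V A))|
    <= e / 2.
  by near: x; exact: Bl.
rewrite (local_mass_convolution _ _ (ltW t0) AAx) -mulrBl.
rewrite [X in X / f x]addrAC subrr add0r.
by move: lA; rewrite !ler_norml => /andP[? ?] /andP[? ?]; lra.
Unshelve. all: by end_near. Qed.
End both_summands_large.

(** * Comparison of convolution tails *)

Section domination.
Context {R : realType}.
Variable F : distr R.
Hypothesis F1 : proportional_increments F 1 F.
Implicit Types (U V : distr R) (c kappa lambda t y : R).

Let f := local_mass F 1.

Lemma both_large_negligible_dominated t U U' V C : 0 <= t -> 0 <= C ->
  (\forall z \near +oo, local_mass U' t z <= C * local_mass U t z) ->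
  both_large_negligible F t U V -> both_large_negligible F t U' V.
Proof.
move=> t0 C0 /near_pinfty_ray[B UU'] UV e e0.
have C1 : 0 < C + 1 by lra.
have eC : 0 < e / (C + 1) by rewrite divr_gt0.
near=> A; have BA : B <= A - t.
  have : B + t <= A by near: A; apply: nbhs_pinfty_ge; exact: num_real.
  by lra.
have : \forall x \near +oo, both_large U V t (A - t) x <= e / (C + 1) * f x.
  by near: A; exact: near_pinfty_shift (UV _ eC).
apply: filterS => x UVx.
have UU'A z : A - t <= z -> local_mass U' t z <= C * local_mass U t z.
  by move=> /(le_trans BA); exact: UU'.
have := both_large_le V x t0 C0 UU'A; rewrite subrK => /le_trans; apply.
apply: le_trans (ler_wpM2l C0 UVx) _.
rewrite mulrA ler_wpM2r ?local_mass_ge0// mulrA ler_pdivrMr// mulrC.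
by rewrite ler_wpM2l ?(ltW e0)//; lra.
Unshelve. all: by end_near. Qed.

Lemma near_local_mass_dominated U kappa t : 0 < t ->
  proportional_increments F kappa U -> exists2 C, 0 <= C &
  \forall z \near +oo, local_mass U t z <= C * local_mass F t z.
Proof.
move=> t0 UF.
have cvg0 V nu : proportional_increments F nu V ->
    local_mass V t x / f x @[x --> +oo] --> nu * t.
  by move=> VF; have := VF t 0 t0; under eq_cvg do rewrite addr0; exact.
have C0 : 0 <= (`|kappa * t| + 1) / (t / 2).
  by rewrite divr_ge0 ?addr_ge0// divr_ge0// ltW.
exists ((`|kappa * t| + 1) / (t / 2)) => //; near=> z.
have fz : 0 < f z by near: z; exact: near_reference_gt0.
have Uf : `|local_mass U t z| <= (`|kappa * t| + 1) * f z.
  by near: z; exact: (cvg_ratio_le F1 (cvg0 _ _ UF)).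
have Ff : t / 2 < local_mass F t z / f z.
  near: z; apply: cvgr_gt (cvg0 _ _ F1) _ _.
  by rewrite mul1r ltr_pdivrMr// ltr_pMr// ltr1n.
apply: le_trans (ler_norm _) (le_trans Uf _).
rewrite -mulrA ler_wpM2l ?addr_ge0// mulrC ler_pdivlMr ?divr_gt0//.
by move: Ff; rewrite ltr_pdivlMr// mulrC => /ltW.
Unshelve. all: by end_near. Qed.

(** The two summands are replaced one after the other, with the symmetry of
    the event in between. *)
Lemma both_large_negligible_increments t U V kappa lambda : 0 < t ->
  proportional_increments F kappa U -> proportional_increments F lambda V ->
  both_large_negligible F t F F -> both_large_negligible F t U V.
Proof.
move=> t0 UF VF FF.
have [C C0 UC] := near_local_mass_dominated t0 UF.
have [D D0 VD] := near_local_mass_dominated t0 VF.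
apply: both_large_negligible_dominated (ltW t0) C0 UC _.
apply: both_large_negligibleC.
exact: both_large_negligible_dominated (ltW t0) D0 VD FF.
Qed.

End domination.

Section tail_comparison.
Context {R : realType}.
Variables (F H : distr R) (K c : R).
Hypothesis F1 : proportional_increments F 1 F.
Hypotheses (F0 : on_half_line F) (H0 : on_half_line H).

Let f := local_mass F 1.
Let g x := tail H x - K * tail F x.

Hypothesis gf : g x / f x @[x --> +oo] --> c.

(** The perturbation contributes g(x + y) - g(x + y + t), and both terms are
    asymptotic to c f(x). *)
Lemma proportional_increments_comparison : proportional_increments F K H.
Proof.
move=> t y t0.
have gfy z := cvg_ratio_shift F1 z gf.
have incr : K * (local_mass F t (x + y) / f x) + g (x + y) / f x -
    g (x + (y + t)) / f x @[x --> +oo] --> K * (1 * t) + c - c.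
  by apply: cvgB => //; apply: cvgD => //; apply: cvgMl_tmp; exact: F1.
move: incr; rewrite addrK mul1r; apply: cvg_near_eq; near=> x.
by rewrite -/f (local_mass_tail F t) (local_mass_tail H t) /g addrA; ring.
Unshelve. all: by end_near. Qed.

Let measurable_g : measurable_fun setT g.
Proof.
apply: measurable_funB; first exact: measurable_tail.
by apply: measurable_funM => //; exact: measurable_tail.
Qed.

Let g_bounded z : `|g z| <= 1 + `|K|.
Proof.
rewrite /g (le_trans (ler_normB _ _))// lerD//.
  by rewrite ger0_norm ?tail_ge0// tail_le1.
by rewrite normrM ler_piMr// ger0_norm ?tail_ge0// tail_le1.
Qed.

Lemma Rintegral_tailB (V : distr R) (D : set R) x : measurable D ->
  \int[V]_(y in D) tail H (x - y) - K * \int[V]_(y in D) tail F (x - y) =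
  \int[V]_(y in D) g (x - y).
Proof.
move=> mD.
have itail W : V.-integrable D (EFin \o (fun y : R => tail W (x - y))).
  apply: (@bounded_integrable _ _ _ V _ 1) => //.
    apply: measurable_funTS; apply: measurableT_comp.
      exact: measurable_tail.
    exact: measurable_funB.
  by move=> y _; rewrite ger0_norm ?tail_ge0 ?tail_le1.
rewrite -RintegralZl// -RintegralB//.
have := integrableZl mD K (itail F).
by apply: eq_integrable.
Qed.

(** Splitting the second summand at [A] and [x - A], the beginning contributes
    c f(x), which [g x] cancels, the middle is negligible since [g] is of the
    order of [f], and the end contributes the difference of the truncated
    means next to the mass correction [(1 - K) * tail V x]. *)
Lemma cvg_tail_convolutionB (V : distr R) kappa : on_half_line V ->
  finite_mean F -> finite_mean H -> proportional_increments F kappa V ->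
  both_large_negligible F 1 F V ->
  (tail (convolution H V) x - K * tail (convolution F V) x - g x -
   (1 - K) * tail V x) / f x @[x --> +oo] --> kappa * (mean H - K * mean F).
Proof.
move=> V0 meanF meanH VF FV; apply: cvg_by_approximation => e e0.
pose m (U : distr R) (A : R) := \int[U]_z Num.min z A.
pose limA (A : R) := c * df V A + kappa * m H A - K * (kappa * m F A) - c.
have limAP : limA A @[A --> +oo] --> kappa * (mean H - K * mean F).
  rewrite (_ : _ * (_ - _) =
    c * 1 + kappa * mean H - K * (kappa * mean F) - c); last by ring.
  apply: cvgB; last exact: cvg_cst.
  apply: cvgB; [apply: cvgD|]; repeat apply: cvgMl_tmp.
  - exact: cvg_df.
  - exact: cvg_truncated_mean.
  - exact: cvg_truncated_mean.
have C0 : 0 < `|c| + 1 by rewrite ltr_pwDr.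
have eC : 0 < e / (`|c| + 1) by rewrite divr_gt0.
have [B gB] := near_pinfty_ray (cvg_ratio_le F1 gf).
have [A [A0 BA lA FVA]] : exists A, [/\ 0 <= A, B <= A,
    `|limA A - kappa * (mean H - K * mean F)| <= e &
    \forall x \near +oo, both_large F V 1 A x <= e / (`|c| + 1) * f x].
  near +oo_(R) => A; exists A; split; near: A => //.
  - by apply: nbhs_pinfty_ge; exact: num_real.
  - by apply: nbhs_pinfty_ge; exact: num_real.
  - by move/cvgrPdistC_le : limAP; exact.
  - exact: FV.
pose r x := (\int[V]_(y in `]-oo, A]) g (x - y)) / f x +
  (\int[H]_z tail V (x - Num.min z A) - tail V x) / f x -
  K * ((\int[F]_z tail V (x - Num.min z A) - tail V x) / f x) - g x / f x.
exists r, (limA A); split => //.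
  apply: cvgB => //; apply: cvgB; [apply: cvgD|apply: cvgMl_tmp].
  - exact: (cvg_near_part F1 V0 A0 measurable_g g_bounded gf).
  - exact: cvg_min_part.
  - exact: cvg_min_part.
near=> x.
have fx : 0 < f x by near: x; exact: near_reference_gt0.
have AAx : A + A <= x by near: x; apply: nbhs_pinfty_ge; exact: num_real.
have -> : (tail (convolution H V) x - K * tail (convolution F V) x - g x -
    (1 - K) * tail V x) / f x - r x =
    (\int[V]_(y in `]A, x - A]) g (x - y)) / f x.
  rewrite /r !(tail_convolution _ _ AAx) -!Rintegral_tailB//.
  by rewrite /g; ring.
have ibounded (phi : R -> R) M : measurable_fun setT phi ->
    (forall z, `|phi z| <= M) ->
    V.-integrable `]A, x - A] (EFin \o (fun y : R => phi (x - y))).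
  move=> mphi phiM; apply: (@bounded_integrable _ _ _ V _ M) => //.
  apply: measurable_funTS; apply: measurableT_comp => //.
  exact: measurable_funB.
rewrite normrM normfV (gtr0_norm fx) ler_pdivrMr//.
have ig := ibounded _ _ measurable_g g_bounded.
have if1 : V.-integrable `]A, x - A] (EFin \o (fun y : R => f (x - y))).
  apply: (ibounded _ 1) => [|z]; first exact: measurable_local_mass.
  by rewrite ger0_norm ?local_mass_ge0 ?local_mass_le1.
apply: le_trans (le_normr_Rintegral _ ig) _ => //.
apply: (@le_trans _ _ (\int[V]_(y in `]A, x - A]) ((`|c| + 1) * f (x - y)))).
  apply: le_Rintegral => //.
  - exact: integrable_norm.
  - have mD : measurable `]A, x - A] by exact: measurable_itv.
    by have := integrableZl mD (`|c| + 1) if1; apply: eq_integrable.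
  - move=> y /=; rewrite in_itv/= => /andP[_ yxA]; apply: gB; lra.
rewrite RintegralZl//.
have FVx : both_large F V 1 A x <= e / (`|c| + 1) * f x by near: x.
have := le_trans (middle_le_both_large F V A x ler01) FVx.
by rewrite mulrAC ler_pdivlMr// mulrC.
Unshelve. all: by end_near. Qed.

End tail_comparison.

(** * Transfer of the defining properties *)

Section transfer.
Context {R : realType}.
Implicit Types (F H V : distr R) (a b f : R -> R) (t l : R).

(** Uniformity in the shift amounts to convergence along every choice of the
    shift as a function of [x]; in this form it is stable under products of
    limits. *)
Lemma local_long_tailed_selection t V : local_long_tailed t V <->
  forall s : R -> R, (forall x, 0 <= s x <= 1) ->
  local_mass V t (x + s x) / local_mass V t x @[x --> +oo] --> (1 : R).
Proof.
rewrite local_long_tailedP; split=> [VL s s01|VL e e0].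
  apply/cvgrPdistC_le => e e0.
  by apply: filterS (VL _ e0) => x; exact.
pose bad x y := 0 <= y <= 1 /\
  ~ `|local_mass V t (x + y) / local_mass V t x - 1| <= e.
pose s x :=
  if pselect (exists y, bad x y) is left ex then projT1 (cid ex) else 0.
have s01 x : 0 <= s x <= 1.
  rewrite /s; case: pselect => [ex|_]; last by rewrite lexx ler01.
  by case: cid => y [].
have /cvgrPdistC_le/(_ _ e0) := VL s s01.
apply: filterS => x; rewrite /s; case: pselect => [ex|nex _ y y01].
  by case: cid => y [].
by apply: contrapT => ybad; apply: nex; exists y.
Qed.

Lemma local_long_tailed_transfer t F H l : l != 0 -> local_long_tailed t F ->
  local_mass H t x / local_mass F t x @[x --> +oo] --> l ->
  local_long_tailed t H.
Proof.
move=> l0 FL HF; apply/local_long_tailed_selection => s s01.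
have /local_long_tailed_selection/(_ _ s01) Fs := FL.
have soo : x + s x @[x --> +oo] --> +oo.
  apply/cvgryPge => A; near=> x; have : A <= x.
    by near: x; apply: nbhs_pinfty_ge; exact: num_real.
  by have := s01 x; move=> /andP[? _] ?; lra.
have HFs :
    local_mass H t (x + s x) / local_mass F t (x + s x) @[x --> +oo] --> l.
  exact: cvg_comp soo HF.
have := cvgV l0 HF => /(_ _) HFV.
have := cvgM HFs HFV => /(_ _) HFr.
have := cvgM HFr Fs => /(_ _).
rewrite divff// mulr1; apply: cvg_near_eq.
have F0 := near_local_mass_neq0 FL; near=> x => /=.
have Fx : local_mass F t x != 0 by near: x.
have Fsx : local_mass F t (x + s x) != 0.
  by near: x; exact: soo F0.
rewrite invf_div; set a := local_mass H t (x + _); set b := local_mass H t x.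
set c := local_mass F t x in Fx *; set d := local_mass F t (x + _) in Fsx *.
rewrite [LHS](_ : _ = a / b * (c / c) * (d / d)); last by ring.
by rewrite !divff// !mulr1.
Unshelve. all: by end_near. Qed.

Lemma asymp_ratio a b f l : l != 0 -> (\forall x \near +oo, f x != 0) ->
  a x / f x @[x --> +oo] --> l -> b x / f x @[x --> +oo] --> l -> asymp a b.
Proof.
move=> l0 f0 af bf.
have := cvgV l0 bf => /(_ _) bfV.
have := cvgM af bfV => /(_ _); rewrite divff//; apply: cvg_near_eq.
by apply: filterS f0 => x fx /=; rewrite invf_div mulrA divfK.
Qed.

Lemma ratio_asymp a b f l : asymp a b ->
  b x / f x @[x --> +oo] --> l -> a x / f x @[x --> +oo] --> l.
Proof.
move=> ab bf; have := cvgM ab bf => /(_ _); rewrite mul1r; apply: cvg_near_eq.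
have : \forall x \near +oo, a x / b x != 0.
  by apply: cvgr_neq0 ab _; exact: oner_neq0.
apply: filterS => x abx /=; rewrite mulrA divfK//.
by apply: contraNneq abx => ->; rewrite invr0 mulr0.
Qed.

Lemma mean_norm V : on_half_line V -> mean V = \int[V]_z `|z|.
Proof.
move=> V0; rewrite /mean unlock; congr fine; apply: ae_eq_integral => //.
  by apply/measurable_EFinP; exact: normr_measurable.
by have := half_line_ae V0; apply: filterS => z z0 _ /=; rewrite ger0_norm.
Qed.

Lemma mean_gt0 V x : on_half_line V -> finite_mean V -> 1 <= x ->
  0 < tail V x -> 0 < mean V.
Proof.
move=> V0 V1 x1 Vx; apply: lt_le_trans Vx _; rewrite mean_norm// tailE.
rewrite -[fine _]mul1r -Rintegral_cst// Rintegral_mkcond.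
apply: le_Rintegral => //.
- rewrite -restrict_EFin; apply/(integrable_mkcond _ _).1 => //.
  exact: finite_measure_integrable_cst.
- exact: integrable_norm.
- move=> z _; rewrite patchE; case: ifPn => [zx|_]; last exact: normr_ge0.
  move: (set_mem zx); rewrite /= in_itv/= andbT => xz.
  by rewrite gtr0_norm; lra.
Qed.

(** The domination of tails is known beyond some level [B] only, so the means
    that are compared, as integrals of tails, are those of the excess over
    [B]. *)
Lemma finite_mean_dominated F H (C : R) : on_half_line H -> finite_mean F ->
  (\forall x \near +oo, tail H x <= C * tail F x) -> finite_mean H.
Proof.
move=> H0 meanF HF.
have [B B0 HFB] : exists2 B, 0 <= B &
    forall x, B <= x -> tail H x <= `|C| * tail F x.
  have [B HFB] := near_pinfty_ray HF; exists (Num.max B 0).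
    by rewrite le_max lexx orbT.
  move=> x; rewrite ge_max => /andP[Bx _]; apply: le_trans (HFB _ Bx) _.
  by rewrite ler_wpM2r ?tail_ge0// ler_norm.
pose excess (z : R) : R := Num.max (z - B) 0.
have mexcess : measurable_fun setT excess.
  by apply: measurable_maxr => //; exact: measurable_funB.
pose X : {mfun R >-> R} := HB.pack excess
  (isMeasurableFun.Build _ _ _ _ excess mexcess).
have X0 z : 0 <= X z by rewrite /= /excess le_max lexx orbT.
have ccdfX V r : 0 <= r -> ccdf (X : {RV V >-> R}) r = (tail V (r + B))%:E.
  move=> r0; rewrite tailE fine_probabilityK// /ccdf /distribution /pushforward.
  congr (V _); apply/seteqP; split=> z /=; rewrite !in_itv/= !andbT /excess.
    by rewrite lt_max => /orP[|]; lra.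
  by move=> ?; rewrite lt_max; apply/orP; left; lra.
have EX V : (\int[V]_z (X z)%:E =
    \int[lebesgue_measure]_(r in `[0%R, +oo[) (tail V (r + B))%:E)%E.
  rewrite -(expectation_def (X : {RV V >-> R})) ge0_expectation_ccdf//.
  apply: eq_integral => r; rewrite inE/= in_itv/= andbT => r0.
  by rewrite ccdfX.
have mtail V : measurable_fun setT (fun r : R => tail V (r + B)).
  by apply: (measurableT_comp (measurable_tail V)); exact: measurable_funD.
have XF : (\int[F]_z (X z)%:E < +oo)%E.
  have /integrableP[_] := meanF; apply: le_lt_trans.
  apply: ge0_le_integral => //.
  - by move=> z _; rewrite lee_fin.
  - exact/measurable_EFinP.
  - by apply/measurable_EFinP; exact: normr_measurable.
  - move=> z _; rewrite /= lee_fin ge_max normr_ge0 andbT.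
    by have := ler_norm z; lra.
have XH : (\int[H]_z (X z)%:E < +oo)%E.
  apply: (@le_lt_trans _ _ (`|C|%:E * \int[F]_z (X z)%:E)%E).
    rewrite !EX -ge0_integralZl_EFin//; last 2 first.
    - by move=> r _; rewrite lee_fin tail_ge0.
    - by apply/measurable_EFinP; apply: measurable_funTS; exact: mtail.
    apply: ge0_le_integral => //.
    - by move=> r _; rewrite lee_fin tail_ge0.
    - by apply/measurable_EFinP; apply: measurable_funTS; exact: mtail.
    - apply: measurable_funeM; apply/measurable_EFinP.
      by apply: measurable_funTS; exact: mtail.
    - move=> r; rewrite /= in_itv/= andbT => r0; rewrite -EFinM lee_fin.
      by apply: HFB; lra.
  by rewrite lte_mul_pinfty// ?lee_fin//.
apply/integrableP; split => //.
apply: (@le_lt_trans _ _ (\int[H]_z (B%:E + (X z)%:E))%E).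
  apply: ae_ge0_le_integral => //.
  - by apply/measurable_EFinP; exact: normr_measurable.
  - by move=> z _; rewrite adde_ge0// lee_fin.
  - by apply: emeasurable_funD => //; exact/measurable_EFinP.
  - have := half_line_ae H0; apply: filterS => z z0 _ /=.
    rewrite -EFinD lee_fin ger0_norm// /excess -lerBlDl le_max lexx//.
rewrite ge0_integralD//.
- have -> : (\int[H]_(z in setT) B%:E = B%:E)%E.
    by have := expectation_cst H B; rewrite unlock.
  by rewrite lte_add_pinfty// ltry.
- by move=> z _; rewrite lee_fin.
- exact/measurable_EFinP.
Qed.

End transfer.

(** * Closure under tail comparison *)

Section closure.
Context {R : realType}.
Variables (F H : distr R) (K c : R).
Hypotheses (F0 : on_half_line F) (H0 : on_half_line H) (K0 : 0 < K).
Hypothesis F1 : proportional_increments F 1 F.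
Hypotheses (meanF : finite_mean F) (meanH : finite_mean H).
Hypothesis FF : both_large_negligible F 1 F F.

Let f := local_mass F 1.

Hypothesis gf : (tail H x - K * tail F x) / f x @[x --> +oo] --> c.

(** With B(U, V) = tail (U * V) - tail U - tail V, the limit is read off from
    B(H, H) =
    (B(H, H) - K B(F, H)) + K (B(H, F) - K B(F, F)) + K^2 B(F, F). *)
Lemma second_order_transfer :
  (tail (convolution F F) x - 2 * tail F x) / f x @[x --> +oo] --> 2 * mean F ->
  (tail (convolution H H) x - 2 * tail H x) / f x @[x --> +oo] -->
  2 * mean H * K.
Proof.
move=> FFf.
have HF := proportional_increments_comparison F1 gf.
have FH := both_large_negligible_increments F1 ltr01 F1 HF FF.
have DH := cvg_tail_convolutionB F1 F0 H0 gf H0 meanF meanH HF FH.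
have DF := cvg_tail_convolutionB F1 F0 H0 gf F0 meanF meanH F1 FF.
pose D V x := (tail (convolution H V) x - K * tail (convolution F V) x -
  (tail H x - K * tail F x) - (1 - K) * tail V x) / f x.
have : D H x + K * D F x + K * K *
    ((tail (convolution F F) x - 2 * tail F x) / f x) @[x --> +oo] -->
    K * (mean H - K * mean F) + K * (1 * (mean H - K * mean F)) +
    K * K * (2 * mean F).
  by apply: cvgD; [apply: cvgD|]; repeat apply: cvgMl_tmp.
rewrite (_ : K * (mean H - K * mean F) + K * (1 * (mean H - K * mean F)) +
  K * K * (2 * mean F) = 2 * mean H * K); last by ring.
apply: cvg_near_eq; near=> x; rewrite /D (tail_convolutionC F H).
by ring.
Unshelve. all: by end_near. Qed.
End closure.

Theorem proposition3 (R : realType) (F H : distr R)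
  (F_half_line : on_half_line F) (H_half_line : on_half_line H)
  (F_S2 : second_order_subexponential F)
  (K c : R) (K_gt0 : 0 < K)
  (tail_cvg : (tail H x - K * tail F x) / local_mass F 1 x
                @[x --> +oo] --> c) :
  second_order_subexponential H.
Proof.
have [_ meanF FS FFtail] := F_S2.
have K_neq0 : K != 0 by rewrite gt_eqF.
have FL t : 0 < t -> local_long_tailed t F by case/FS.
have F1 := proportional_increments_self FL.
have HF := proportional_increments_comparison F1 tail_cvg.
have f_gt0 := near_reference_gt0 F1.
have f_neq0 : \forall x \near +oo, local_mass F 1 x != 0.
  by apply: filterS f_gt0 => x; exact: lt0r_neq0.
have ratio V nu t : 0 < t -> proportional_increments F nu V ->
    local_mass V t x / local_mass F 1 x @[x --> +oo] --> nu * t.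
  by move=> t0 VF; have := VF t 0 t0; under eq_cvg do rewrite addr0; exact.
have ratioM V nu t k : 0 < t -> proportional_increments F nu V ->
    k * local_mass V t x / local_mass F 1 x @[x --> +oo] --> k * (nu * t).
  move=> t0 VF; under eq_cvg do rewrite -mulrA.
  by apply: cvgMl_tmp; exact: ratio.
have FF t : 0 < t -> both_large_negligible F t F F.
  move=> t0.
  apply: (local_mass_convolution_negligible
            F1 F_half_line F_half_line F1 F1 t0).
  have [_ FFt] := FS t t0; apply: ratio_asymp FFt _.
  rewrite (_ : (1 + 1) * t = 2 * (1 * t)); first exact: ratioM.
  by rewrite mul1r.
have meanH : finite_mean H.
  apply: (@finite_mean_dominated _ F H (`|c| + 1 + K)) => //.
  apply: filterS (cvg_ratio_le F1 tail_cvg) => x /(le_trans (ler_norm _)) gx.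
  have := local_mass_tail F 1 x; have := tail_ge0 F (x + 1) => tail1 fE.
  have : (`|c| + 1) * local_mass F 1 x <= (`|c| + 1) * tail F x.
    by rewrite ler_wpM2l ?addr_ge0// fE; lra.
  by move: gx; rewrite [(_ + K) * _]mulrDl; lra.
split => // [t t0|].
  split.
    apply: (local_long_tailed_transfer K_neq0 (FL t t0)).
    have t_neq0 : 1 * t != 0 by rewrite mul1r gt_eqF.
    have := cvgV t_neq0 (ratio F 1 t t0 F1) => /(_ _) Fv.
    have := cvgM (ratio H K t t0 HF) Fv => /(_ _).
    rewrite mul1r mulfK ?gt_eqF//; apply: cvg_near_eq.
    apply: filterS f_neq0 => x fx /=.
    by rewrite invf_div mulrA divfK.
  apply: (@asymp_ratio _ _ _ (local_mass F 1) (2 * (K * t))) => //.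
  - by rewrite !mulf_neq0// ?gt_eqF.
  - rewrite (_ : 2 * (K * t) = (K + K) * t); last by ring.
    apply: (local_mass_convolution_cvg F1 H_half_line H_half_line HF HF t0).
    exact: (both_large_negligible_increments F1 t0 HF HF (FF t t0)).
  - exact: ratioM.
have meanH_gt0 : 0 < mean H.
  have : \forall x \near +oo, 0 < tail H x.
    have HF_gt0 : \forall x \near +oo, 0 < local_mass H 1 x / local_mass F 1 x.
      by apply: cvgr_gt (ratio H K 1 ltr01 HF) _ _; rewrite mulr1.
    apply: filterS2 f_gt0 HF_gt0 => x fx.
    rewrite -(ltr_pM2r fx) mul0r divfK ?gt_eqF// => hx.
    by have := local_mass_tail H 1 x; have := tail_ge0 H (x + 1); lra.
  move=> /near_pinfty_ray[B HB].
  apply: (@mean_gt0 _ _ (Num.max B 1)) => //; first by rewrite le_max lexx orbT.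
  by apply: HB; rewrite le_max lexx.
apply: (@asymp_ratio _ _ _ (local_mass F 1) (2 * mean H * K)) => //.
- by rewrite !mulf_neq0// ?gt_eqF.
- apply: (second_order_transfer F_half_line H_half_line F1 meanF meanH
            (FF 1 ltr01) tail_cvg).
  apply: ratio_asymp FFtail _.
  by have := ratioM F 1 1 (2 * mean F) ltr01 F1; rewrite !mulr1.
- by have := ratioM H K 1 (2 * mean H) ltr01 HF; rewrite mulr1.
Qed.
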